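(* Suppose $A$ is a commutative, semiprime, Zariski-closed $F$-subalgebra of a finite dimensional commutative $K$-algebra $B$. Then, with respect to a suitable choice of $K$-base of $B$, the ideal $\operatorname{pol}(A)$ is generated by finitely many polynomial relations of Frobenius type.
   Context: $F\subseteq K$ are fields, $F$ finite or infinite, $K$ algebraically closed, and $n=\dim_K B$. Fix a $K$-base $b_1,\dots,b_n$ of $B$; then $B$ is identified with $K^{n}$ via $\sum\alpha_i b_i\leftrightarrow(\alpha_1,\dots,\alpha_n)$ and every $f\in K[\lambda_1,\dots,\lambda_n]$ is viewed as a function $B\to K$, $f(\sum\alpha_i b_i)=f(\alpha_1,\dots,\alpha_n)$. $B$ carries the Zariski topology, and $A\subseteq B$ is Zariski-closed if it is closed in it (independent of the base). A polynomial relation of $A$ is an $f$ with $f(a)=0$ for all $a\in A$; $\operatorname{pol}(A)$, the set of all polynomial relations of $A$, is an ideal of $K[\lambda_1,\dots,\lambda_n]$ (depending on the base). Let $p=\operatorname{char}F$; a $p$-power is $p^j$ with $j\ge 0$ (only $1$ if $p=0$). A polynomial relation is of Frobenius type if it has one of the forms: (i) $\lambda_i=0$; (ii) $\lambda_i-\lambda_i^s=0$ with $s$ a $p$-power; (iii) $\lambda_i-\lambda_j^s=0$ with $j\neq i$ and $s$ a $p$-power. *)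

(* Defs.v *)
From mathcomp Require Import all_boot all_order all_algebra all_field.
From mathcomp Require Export mpoly.

Set Implicit Arguments.
Unset Strict Implicit.
Unset Printing Implicit Defensive.

Import GRing.Theory.
Local Open Scope ring_scope.

Section Algebras.

Variables (F K : fieldType) (iota : {rmorphism F -> K}) (B : falgType K).
Implicit Types (A I : B -> Prop).

Definition is_subspace A : Prop :=
  [/\ A 0,
      forall x y, A x -> A y -> A (x + y)
    & forall (c : F) x, A x -> A (iota c *: x)].

(* A subalgebra is not required to contain the unit of B. *)
Definition is_subalg A : Prop :=
  is_subspace A /\ forall x y, A x -> A y -> A (x * y).

Definition is_ideal A I : Prop :=
  [/\ is_subspace I,
      forall x, I x -> A x
    & forall a x, A a -> I x -> I (a * x) /\ I (x * a)].

(* As 1 != 0 in B, only k > 0 can satisfy the condition. *)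
Definition nilpotent_set I : Prop :=
  exists k : nat, forall x : 'I_k -> B,
    (forall i, I (x i)) -> \prod_(i < k) x i = 0.

Definition commutative_on A : Prop :=
  forall x y, A x -> A y -> x * y = y * x.

Definition semiprime A : Prop :=
  forall I, is_ideal A I -> nilpotent_set I -> forall x, I x -> x = 0.

End Algebras.

Section PolynomialRelations.

Variables (K : fieldType) (B : falgType K).

Let n := \dim {:B}.

Implicit Types (b : n.-tuple B) (f : {mpoly K[n]}) (A : B -> Prop).

Definition mpoly_fun b f (x : B) : K := f.@[fun i => coord b i x].

(* The closed sets do not depend on the base b. *)
Definition zariski_closed b A : Prop :=
  exists S : {mpoly K[n]} -> Prop,
    forall x, A x <-> (forall f, S f -> mpoly_fun b f x = 0).

Definition pol b A f : Prop := forall a, A a -> mpoly_fun b f a = 0.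

End PolynomialRelations.

Definition char_power (R : nzRingType) (s : nat) : Prop :=
  s = 1%N \/ exists p j : nat, p \in [pchar R] /\ s = (p ^ j)%N.

Definition frobenius_type (F K : fieldType) (n : nat) (f : {mpoly K[n]}) : Prop :=
  [\/ exists i : 'I_n, f = 'X_i,
      exists (i : 'I_n) (s : nat), char_power F s /\ f = 'X_i - 'X_i ^+ s
    | exists (i j : 'I_n) (s : nat),
        [/\ j != i, char_power F s & f = 'X_i - 'X_j ^+ s]].

Definition in_generated_ideal (R : comNzRingType) (gs : seq R) (f : R) : Prop :=
  exists c : 'I_(size gs) -> R, f = \sum_(i < size gs) c i * gs`_i.

(* Main.v *)
Require Import Defs.
From mathcomp Require Import all_boot all_order all_algebra all_field.
From mathcomp Require Import ring.
From HB Require Import structures.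
From Stdlib Require Import Classical.

Set Implicit Arguments.
Unset Strict Implicit.
Unset Printing Implicit Defensive.

Import GRing.Theory.
Local Open Scope ring_scope.

(** The theorem reduces to a statement about subsets [T] of [K ^ n] that are
    closed under coordinatewise addition and multiplication. On such a [T] every
    coordinate [x_i] is both additive and multiplicative, and
    [frobenius_generators] shows, over any field, that the polynomials vanishing
    on [T] are generated by relations of Frobenius type. Indeed, such relations
    eliminate the coordinates that vanish on [T] or are a [p]-power of another
    one, and lower the exponents of the coordinates with [x_u = x_u ^ s], [s > 1].
    The remaining monomials are linearly independent as functions on [T]
    ([vanishes_supported_eq0]): as in Artin's theorem on additive maps, a
    relation of least degree is additive, that is, a linear combination of
    [p]-powers [x_u ^ (p ^ j)]. These are pairwise distinct multiplicative
    functions on [T], so Dedekind's argument ([vanishes_distinct_monomials])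
    shows that the relation is trivial.

    It remains to find a base of [B] in which the coordinate vectors of [A] are
    closed under multiplication. In characteristic 0 the field [F] is infinite,
    so a Zariski-closed [A] is a [K]-subspace, and any base that extends a base of
    [A] will do.

    In characteristic [p], write [B = S + N], where [S] is spanned by orthogonal
    idempotents and [N] consists of the nilpotent elements
    ([idempotent_nilpotent_basis]). The claim is that [A] lies in [S]
    ([A_semisimple]), where multiplication is coordinatewise. Let [s(a)] be
    the component in [S] of [a] in [A], and let [q] be a power of [p] so large
    that [a ^ q = s(a) ^ q] for all [a]. The elements [s(a) ^ q] are closed under
    addition and multiplication, so a polynomial that vanishes on [A], hence on
    them, is a combination of Frobenius relations that hold for them. Since
    [x ^ q] determines [x] in [K], these relations hold for the elements [s(a)],
    and so does the polynomial. As [A] is closed, [s(a)] lies in [A]; then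
    [a - s(a)] is a nilpotent element of [A], and it is [0] because [A] is
    semiprime. *)

(** * Powers of the characteristic *)

Lemma char_powerE (R : nzRingType) s :
  char_power R s <-> ([pchar R].-nat s)%N.
Proof.
split=> [[-> //|[p [j [pR ->]]]]|s_nat].
  by rewrite pnatX (eq_pnat _ (pcharf_eq pR)) pnat_id ?(pcharf_prime pR).
have [|s_gt1] := leqP s 1.
  by case: s s_nat => [|[|s]] // _ _; left.
have pR : pdiv s \in [pchar R] by rewrite (pnatPpi s_nat) ?pi_pdiv.
right; exists (pdiv s).
have /p_natP[j sE] : (pdiv s).-nat s by rewrite -(eq_pnat _ (pcharf_eq pR)).
by exists j.
Qed.

Lemma char_power1 (R : nzRingType) : char_power R 1.
Proof. by left. Qed.

Lemma char_power_gt0 (R : nzRingType) s : char_power R s -> (0 < s)%N.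
Proof. by move/char_powerE/andP=> []. Qed.

Lemma char_powerM (R : nzRingType) s t :
  char_power R s -> char_power R t -> char_power R (s * t).
Proof. by rewrite !char_powerE pnatM => -> ->. Qed.

Lemma char_power_dvd (R : nzRingType) s t :
  char_power R s -> char_power R t -> (s <= t)%N ->
  exists2 r, char_power R r & t = (s * r)%N.
Proof.
move=> s_pow t_pow le_st.
suff dvd_st : (s %| t)%N.
  exists (t %/ s)%N; last by rewrite mulnC divnK.
  apply/char_powerE; apply: pnat_dvd (dvdn_div dvd_st) _.
  exact/char_powerE.
case: (s_pow) => [-> //|[p [j [pR sE]]]].
move/char_powerE: t_pow; rewrite (eq_pnat _ (pcharf_eq pR)).
case/p_natP=> l tE; move: le_st; rewrite sE tE.
by rewrite leq_exp2l ?prime_gt1 ?(pcharf_prime pR) //; apply: dvdn_exp2l.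
Qed.

Lemma char_power_exprD (R : comNzRingType) s (x y : R) :
  char_power R s -> (x + y) ^+ s = x ^+ s + y ^+ s.
Proof. by move/char_powerE; apply: exprDn_pchar. Qed.

Lemma char_power_exprB (R : comNzRingType) s (x y : R) :
  char_power R s -> (x - y) ^+ s = x ^+ s - y ^+ s.
Proof.
by move=> s_pow; apply/eqP; rewrite eq_sym subr_eq -char_power_exprD // subrK.
Qed.

Lemma char_power_inj (K : fieldType) s (x y : K) :
  char_power K s -> x ^+ s = y ^+ s -> x = y.
Proof.
move=> s_pow xy; apply/eqP; rewrite -subr_eq0.
have: (x - y) ^+ s == 0 by rewrite char_power_exprB // xy subrr.
by rewrite expf_eq0 => /andP[].
Qed.

(** Comparing the coefficients of [(1 + X) ^ k = (1 + X ^ q) ^ r], where [q] is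
    the largest power of the characteristic that divides [k] ([1] in
    characteristic 0), gives [C(k, q) = r], which is invertible. *)
Lemma bin_neq0_char (K : fieldType) k :
  (0 < k)%N -> ~ char_power K k ->
  exists2 l, (0 < l < k)%N & ('C(k, l))%:R != 0 :> K.
Proof.
move=> k_gt0 k_npow; pose q := (k`_[pchar K])%N; pose r := (k`_[pchar K]^')%N.
have kE : k = (q * r)%N by rewrite partnC.
have q_gt0 : (0 < q)%N by apply: part_gt0.
have r_gt1 : (1 < r)%N.
  rewrite ltnNge; apply/negP=> r_le1; apply: k_npow; apply/char_powerE.
  have r1 : r = 1%N by apply/eqP; rewrite eqn_leq r_le1 part_gt0.
  by rewrite kE r1 muln1 part_pnat.
exists q; first by rewrite q_gt0 [X in (_ < X)%N]kE ltn_Pmulr.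
have: (1 + 'X : {poly K}) ^+ k = (1 + 'X^q) ^+ r.
  rewrite kE exprM exprDn_pchar ?expr1n //.
  have pcharP : [pchar {poly K}] =i [pchar K] by apply: pchar_poly.
  by rewrite (eq_pnat _ pcharP) part_pnat.
move/(congr1 (fun f : {poly K} => f`_q)).
rewrite !exprDn !coef_sum.
under eq_bigr do rewrite expr1n mul1r coefMn coefXn.
under [in RHS]eq_bigr do rewrite expr1n mul1r coefMn -exprM coefXn.
have le_qk : (q < k.+1)%N by rewrite ltnS [X in (_ <= X)%N]kE leq_pmulr // ltnW.
rewrite (bigD1 (Ordinal le_qk)) //= eqxx big1 ?addr0; last first.
  by move=> i /negPf; rewrite -val_eqE /= eq_sym => ->; rewrite mul0rn.
have lt_1r : (1 < r.+1)%N by rewrite ltnW.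
rewrite (bigD1 (Ordinal lt_1r)) //= muln1 eqxx big1 ?addr0; last first.
  move=> i /negPf; rewrite -val_eqE /= -[X in X == (_ * _)%N]muln1.
  by rewrite eqn_pmul2l // eq_sym => ->; rewrite mul0rn.
by rewrite bin1 => ->; rewrite natf_neq0_pchar part_pnat.
Qed.

(** * Linear independence of monomials on a set closed under both operations *)

Lemma mem_msupp_sum (K : fieldType) n (I : eqType) (r : seq I)
    (c : I -> K) (h : I -> 'X_{1..n}) m :
  m \in msupp (\sum_(i <- r) c i *: 'X_[h i]) ->
  exists2 i, i \in r & c i != 0 /\ m = h i.
Proof.
rewrite mcoeff_msupp raddf_sum /= => nz.
have [i [ir ci]] : exists i, i \in r /\ (c i *: 'X_[h i])@_m != 0.
  apply: NNPP => H; case/eqP: nz; rewrite big_seq big1 // => i ir.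
  by apply/eqP; apply: contraPT H => H; apply; exists i.
exists i => //; move: ci; rewrite mcoeffZ mcoeffX mulf_eq0 negb_or.
by case/andP=> ci; case: (h i =P m) => [->|_]; rewrite ?eqxx.
Qed.

Section Independence.

Variables (K : fieldType) (n : nat) (T : ('I_n -> K) -> Prop).

Implicit Types (f g : {mpoly K[n]}) (v w : 'I_n -> K) (m : 'X_{1..n}).

Definition vanishes f := forall v, T v -> f.@[v] = 0.

Hypothesis TM : forall v w, T v -> T w -> T (fun i => v i * w i).

Lemma mevalXM m v w :
  'X_[m].@[fun i => v i * w i] = 'X_[m].@[v] * 'X_[m].@[w] :> K.
Proof.
by rewrite !mevalX -big_split; apply: eq_bigr => i _; rewrite exprMn.
Qed.

Lemma meval_msupp f v : f.@[v] = \sum_(m <- msupp f) f@_m * 'X_[m].@[v].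
Proof. by rewrite mevalE; apply: eq_bigr => m _; rewrite mevalX. Qed.

(** Dedekind's independence of characters: every monomial is a multiplicative
    function on [T], and a point where two of them differ serves to cancel one of
    them from a relation. *)
Lemma vanishes_distinct_monomials f :
  (forall m, m \in msupp f -> exists2 v, T v & 'X_[m].@[v] != 0 :> K) ->
  {in msupp f &, forall m m', m != m' ->
    exists2 v, T v & 'X_[m].@[v] != 'X_[m'].@[v] :> K} ->
  vanishes f -> f = 0.
Proof.
have [d] := ubnP (size (msupp f)); elim: d f => // d IH f; rewrite ltnS => le_d.
move=> f_nz f_dist f_van; apply/eqP; rewrite -msupp_eq0.
case fE : (msupp f) => [//|m0 [|m1 s]].
  have m0f : m0 \in msupp f by rewrite fE mem_head.
  have [v Tv v_nz] := f_nz _ m0f.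
  have := f_van _ Tv; rewrite meval_msupp fE big_seq1 => /eqP.
  by rewrite mulf_eq0 (negPf v_nz) orbF mcoeff_eq0 m0f.
have m0f : m0 \in msupp f by rewrite fE mem_head.
have m1f : m1 \in msupp f by rewrite fE !inE eqxx orbT.
have m01 : m1 != m0.
  by have := msupp_uniq f; rewrite fE /= inE eq_sym; case: eqP.
have [w Tw w_dist] := f_dist _ _ m1f m0f m01.
(* The difference of [f (w x)] and [w ^ m0 * f x] has lost the monomial [m0]
   and kept [m1]. *)
pose c m : K := f@_m * ('X_[m].@[w] - 'X_[m0].@[w]).
pose g := \sum_(m <- msupp f) c m *: 'X_[m].
have g_coef m : m \in msupp f -> g@_m = c m.
  move=> mf; rewrite raddf_sum /= (bigD1_seq m) ?msupp_uniq //= big1.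
    by rewrite mcoeffZ mcoeffX eqxx mulr1 addr0.
  by move=> m' /negPf m'm; rewrite mcoeffZ mcoeffX m'm mulr0.
have g_supp m : m \in msupp g -> m \in msupp f.
  by case/mem_msupp_sum => m' m'f [_ ->].
have g0 : g = 0.
  apply: IH.
  - apply: leq_trans le_d.
    have lt_rem : (size (rem m0 (msupp f)) < size (msupp f))%N.
      by rewrite size_rem // fE.
    apply: leq_ltn_trans lt_rem; apply: uniq_leq_size (msupp_uniq _) _ => m mg.
    rewrite (mem_rem_uniq _ (msupp_uniq f)) !inE g_supp // andbT.
    by apply: contraTneq mg => ->; rewrite -mcoeff_eq0 g_coef // /c subrr mulr0.
  - by move=> m /g_supp; apply: f_nz.
  - by move=> m m' /g_supp mf /g_supp; apply: f_dist.
  move=> v Tv; rewrite /g raddf_sum /=.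
  under eq_bigr => m _ do rewrite mevalZ /c mulrBr mulrBl.
  rewrite sumrB.
  under eq_bigr => m _ do rewrite -mulrA -mevalXM.
  under [in X in _ - X]eq_bigr => m _ do rewrite mulrAC.
  by rewrite -meval_msupp -mulr_suml -meval_msupp !f_van ?mul0r ?subrr //; exact: TM.
have := g_coef _ m1f; rewrite g0 mcoeff0 => /esym/eqP.
rewrite mulf_eq0 subr_eq0 (negPf w_dist) orbF.
by rewrite mcoeff_eq0 m1f.
Qed.

Hypothesis T0 : T (fun=> 0).
Hypothesis TD : forall v w, T v -> T w -> T (fun i => v i + w i).

Definition mbin m m' : nat := \prod_i 'C(m i, m' i).

Lemma mbin_small m m' : ~~ (m' <= m)%MM -> mbin m m' = 0%N.
Proof.
move=> nle; have [i lt_i] : exists i, (m i < m' i)%N.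
  apply: NNPP => H; case/negP: nle; apply/mnm_lepP => i.
  by rewrite leqNgt; apply/negP => lt_i; apply: H; exists i.
by rewrite /mbin (bigD1 i) //= bin_small.
Qed.

(** The divided power [1 / m! * D ^ m], which makes sense in every
    characteristic. *)
Definition hasse m f : {mpoly K[n]} :=
  \sum_(m' <- msupp f) (f@_m' * (mbin m' m)%:R) *: 'X_[m' - m].

Lemma mcoeff_hasse m f m' :
  (hasse m f)@_m' = f@_(m + m') * (mbin (m + m') m)%:R.
Proof.
rewrite raddf_sum /=.
under eq_bigr => k _ do rewrite mcoeffZ mcoeffX.
have termE k : k != (m + m')%MM ->
    f@_k * (mbin k m)%:R * (k - m == m')%MM%:R = 0 :> K.
  move=> k_neq; case: (boolP (m <= k)%MM) => [le_mk|]; last first.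
    by move/mbin_small=> ->; rewrite mulr0 mul0r.
  case: eqP => [km|]; last by rewrite mulr0.
  by case/eqP: k_neq; rewrite -km addmC submK.
have [mf|mf] := boolP ((m + m')%MM \in msupp f); last first.
  rewrite (memN_msupp_eq0 mf) mul0r big_seq big1 // => k kf.
  by apply: termE; apply: contraNneq mf => <-.
rewrite (bigD1_seq (m + m')%MM) ?msupp_uniq //= big1 ?addr0.
  by rewrite addmC addmK eqxx mulr1.
by move=> k; apply: termE.
Qed.

(** The polynomial [f (x + v)] in [x]. All exponents that occur in [f] are less
    than [msize f]. *)
Definition taylor v f : {mpoly K[n]} :=
  \sum_(e : {ffun 'I_n -> 'I_(msize f)})
    (hasse [multinom (e i : nat) | i < n] f).@[v] *:
      'X_[[multinom (e i : nat) | i < n]].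

Lemma mcoeff_taylor v f m : (taylor v f)@_m = (hasse m f).@[v].
Proof.
rewrite raddf_sum /=.
under eq_bigr => e _ do rewrite mcoeffZ mcoeffX.
have [lt_m|nlt_m] := boolP [forall i, (m i < msize f)%N].
  pose e0 := [ffun i => Ordinal (forallP lt_m i)].
  have e0E : [multinom (e0 i : nat) | i < n] = m.
    by apply/mnmP => i; rewrite mnmE ffunE.
  rewrite (bigD1 e0) //= e0E eqxx mulr1 big1 ?addr0 // => e e_neq.
  case: eqP => [eE|]; last by rewrite mulr0.
  case/eqP: e_neq; apply/ffunP => i; rewrite ffunE; apply: val_inj => /=.
  by rewrite -eE mnmE.
case/forallPn: nlt_m => i; rewrite -leqNgt => le_i.
rewrite big1 => [|e _]; last first.
  case: eqP => [eE|]; last by rewrite mulr0.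
  by move: le_i; rewrite -eE mnmE leqNgt ltn_ord.
suff -> : hasse m f = 0 by rewrite meval0.
rewrite /hasse big_seq big1 // => k /msize_mdeg_lt lt_k.
rewrite mbin_small ?mulr0 ?scale0r //; apply/negP => /mnm_lepP /(_ i).
rewrite leqNgt (leq_trans _ le_i) //.
by apply: leq_ltn_trans lt_k; rewrite mdegE (bigD1 i) //= leq_addr.
Qed.

Lemma meval_taylor v w f : (taylor v f).@[w] = f.@[fun i => w i + v i].
Proof.
rewrite raddf_sum /=.
under eq_bigr => e _ do rewrite mevalZ raddf_sum mulr_suml /=.
rewrite exchange_big meval_msupp !big_seq; apply: eq_bigr => m mf.
under eq_bigr => e _ do rewrite mevalZ -!mulrA.
rewrite -mulr_sumr; congr (_ * _); rewrite !mevalX.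
have lt_m i : (m i < msize f)%N.
  apply: leq_ltn_trans (msize_mdeg_lt mf).
  by rewrite mdegE (bigD1 i) //= leq_addr.
pose F i (k : nat) : K := ('C(m i, k))%:R * (v i ^+ (m i - k) * w i ^+ k).
transitivity (\prod_i \sum_(k < msize f) F i k); last first.
  apply: eq_bigr => i _; rewrite addrC exprDn.
  rewrite -(big_mkord xpredT (F i)) -(big_mkord xpredT
    (fun k => v i ^+ (m i - k) * w i ^+ k *+ 'C(m i, k))).
  rewrite [LHS](big_cat_nat (n := (m i).+1)) //= [X in _ + X]big1_seq ?addr0.
    by apply: eq_bigr => k _; rewrite /F mulr_natl.
  by move=> k; rewrite mem_index_iota => /andP[_ /andP[lt_k _]];
    rewrite /F bin_small // mul0r.
rewrite bigA_distr_bigA /=; apply: eq_bigr => e _.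
rewrite /mbin natr_prod !mevalX -!big_split /=.
by apply: eq_bigr => i _; rewrite /F !mnmE.
Qed.

Lemma mbin_disjoint m m' : (forall i, m i = 0 \/ m' i = 0)%N ->
  mbin (m + m') m = 1%N.
Proof.
move=> dis; rewrite /mbin big1 // => i _; rewrite mnmDE.
by case: (dis i) => ->; rewrite ?addn0 ?binn ?bin0.
Qed.

(** [R] stands for the exponents that occur in normal forms modulo the Frobenius
    relations. *)
Variable R : 'X_{1..n} -> Prop.
Hypothesis R_down : forall m m', (m <= m')%MM -> R m' -> R m.

Definition supported f := forall m, m \in msupp f -> R m.

(** Artin's argument. For [v] in [T] the polynomial [f (x + v) - f x] vanishes on
    [T] and has a smaller degree than [f], hence it is [0]. So the Hasse
    derivative of [f] at [m] is equal to the constant [f@_m] on [T]; when [m] is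
    not [0], its degree is smaller than that of [f], hence it is this constant. *)
Lemma vanishes_additive_step f :
  (forall g, (msize g < msize f)%N -> supported g -> vanishes g -> g = 0) ->
  supported f -> vanishes f ->
  forall m m', m != 0%MM -> m' != 0%MM -> f@_(m + m') * (mbin (m + m') m)%:R = 0.
Proof.
move=> IH f_R f_van m m' m_nz m'_nz.
have sizeP g d : (forall k, k \in msupp g -> (mdeg k < d)%N) -> (msize g <= d)%N.
  by move=> H; rewrite msizeE big_seq; elim/big_ind: _ => // x y;
    rewrite geq_max => -> ->.
have hasse_R k k' : (hasse k f)@_k' != 0 -> (k + k')%MM \in msupp f.
  by rewrite mcoeff_hasse mulf_eq0 negb_or -mcoeff_msupp => /andP[].
have [->|f_nz] := eqVneq f 0; first by rewrite mcoeff0 mul0r.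
have size_f : (0 < msize f)%N by rewrite lt0n msize_poly_eq0.
have deg_f k : k \in msupp f -> (mdeg k <= (msize f).-1)%N.
  by move=> /msize_mdeg_lt lt_k; rewrite -ltnS prednK.
have hasse_const v k : T v -> (hasse k f).@[v] = f@_k.
  move=> Tv; rewrite -mcoeff_taylor.
  suff /eqP : taylor v f - f = 0 by rewrite subr_eq0 => /eqP ->.
  have coefP k' : k' \in msupp (taylor v f - f) ->
      exists2 k2, (k' + k2)%MM \in msupp f & k2 != 0%MM.
    rewrite mcoeff_msupp mcoeffB mcoeff_taylor meval_msupp => nz.
    apply: NNPP => H; case/eqP: nz.
    have coef0 k2 : k2 != 0%MM -> (hasse k' f)@_k2 = 0.
      move=> k2_nz; apply/eqP; apply: contraPT H => /hasse_R k'f.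
      by apply; exists k2.
    have coefE : (hasse k' f)@_0 = f@_k'.
      rewrite mcoeff_hasse addm0; suff -> : mbin k' k' = 1%N by rewrite mulr1.
      by rewrite /mbin big1 // => i _; rewrite binn.
    rewrite -meval_msupp; suff -> : hasse k' f = (f@_k')%:MP.
      by rewrite mevalC subrr.
    apply/mpolyP => k2; rewrite mcoeffC; case: eqVneq => [->|/coef0 ->].
      by rewrite mulr1.
    by rewrite mulr0.
  apply: IH.
  - rewrite -[X in (_ < X)%N](prednK size_f) ltnS.
    apply: sizeP => k' /coefP [k2 /deg_f le_k k2_nz].
    by apply: leq_trans le_k; rewrite mdegD -addn1 leq_add2l lt0n mdeg_eq0.
  - by move=> k' /coefP [k2 /f_R Rk _]; apply: R_down Rk; apply: lem_addr.
  by move=> w Tw; rewrite mevalB meval_taylor !f_van ?subrr //; apply: TD.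
have suppP k : k \in msupp (hasse m f - (f@_m)%:MP) ->
    (m + k)%MM \in msupp f.
  rewrite mcoeff_msupp mcoeffB mcoeffC; have [->|k_nz] := eqVneq k 0%MM.
    rewrite mcoeff_hasse addm0 mulr1.
    apply: contraR => /memN_msupp_eq0 ->.
    by rewrite mul0r subrr.
  by rewrite mulr0 subr0 => /hasse_R.
suff : hasse m f - (f@_m)%:MP = 0.
  move/(congr1 (mcoeff m')).
  by rewrite mcoeffB mcoeffC (negPf m'_nz) mulr0 subr0 mcoeff0 mcoeff_hasse.
apply: IH.
- rewrite -[X in (_ < X)%N](prednK size_f) ltnS.
  apply: sizeP => k /suppP /deg_f; apply: leq_trans.
  by rewrite mdegD -add1n leq_add2r lt0n mdeg_eq0.
- by move=> k /suppP /f_R; apply: R_down; apply: lem_addl.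
by move=> v Tv; rewrite mevalB mevalC hasse_const // subrr.
Qed.

Hypothesis R_nz : forall i s, char_power K s -> R (U_(i) *+ s)%MM ->
  exists2 v, T v & v i != 0.
Hypothesis R_dist : forall i j s t, char_power K s -> char_power K t ->
  R (U_(i) *+ s)%MM -> R (U_(j) *+ t)%MM -> (i, s) != (j, t) ->
  exists2 v, T v & v i ^+ s != v j ^+ t.

Lemma mevalXUn i s v : 'X_[U_(i) *+ s].@[v] = v i ^+ s :> K.
Proof. by rewrite -mpolyXn rmorphXn /= mevalXU. Qed.

(** If [f] is a counterexample of least degree, no monomial [m] of [f] has a
    decomposition [m = m1 + m2] with [m1] and [m2] nonzero and the binomial
    coefficient of [m] and [m1] invertible. Hence [m] involves a single variable,
    its exponent is a power of the characteristic, and the Dedekind argument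
    applies. *)
Lemma vanishes_supported_eq0 f : supported f -> vanishes f -> f = 0.
Proof.
have [d] := ubnP (msize f); elim: d f => // d IH f; rewrite ltnS => le_d f_R f_van.
have step := vanishes_additive_step
  (fun g lt_g => IH g (leq_trans lt_g le_d)) f_R f_van.
have powP m : m \in msupp f ->
    exists i s, char_power K s /\ m = (U_(i) *+ s)%MM.
  (* The constant term is the value at the point [0] of [T]. *)
  move=> mf; have m_nz : m != 0%MM.
    apply: contraTneq mf => ->; rewrite -mcoeff_eq0.
    have := f_van _ T0; rewrite meval_msupp.
    under eq_bigr => k _.
      have -> : 'X_[k].@[fun=> 0] = (k == 0%MM)%:R :> K.
        have [->|k_nz] := eqVneq k 0%MM; first by rewrite mpolyX0 meval1.
        have [i ki] : exists i, k i != 0%N.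
          apply: NNPP => H; case/eqP: k_nz; apply/mnmP => i; rewrite mnm0E.
          by apply/eqP; apply: contraPT H => ki; apply; exists i.
        by rewrite mevalX (bigD1 i) //= expr0n (negPf ki) mul0r.
      over.
    move=> <-; apply/eqP; have [m0f|/memN_msupp_eq0 m0f] := boolP (0%MM \in msupp f).
      rewrite (bigD1_seq 0%MM) ?msupp_uniq //= big1 ?addr0 ?eqxx ?mulr1 //.
      by move=> k /negPf ->; rewrite mulr0.
    rewrite m0f big1 // => k _; case: eqP => [->|_]; last by rewrite mulr0.
    by rewrite m0f mul0r.
  have [i mi] : exists i, m i != 0%N.
    apply: NNPP => H; case/eqP: m_nz; apply/mnmP => i; rewrite mnm0E.
    by apply/eqP; apply: contraPT H => ki; apply; exists i.
  have split_nz m1 m2 : m = (m1 + m2)%MM -> m1 != 0%MM -> m2 != 0%MM ->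
      (mbin m m1)%:R = 0 :> K.
    move=> mE m1_nz m2_nz; have := step _ _ m1_nz m2_nz; rewrite -mE => /eqP.
    by rewrite mulf_eq0 mcoeff_eq0 mf /= => /eqP.
  have mE : m = (U_(i) *+ m i)%MM.
    apply: NNPP => m_neq.
    pose m1 := (U_(i) *+ m i)%MM.
    have m1E j : m1 j = if i == j then m i else 0%N.
      by rewrite mulmnE mnm1E; case: eqP; rewrite ?mul1n.
    have le_m1 : (m1 <= m)%MM.
      by apply/mnm_lepP => j; rewrite m1E; case: eqP => [->|].
    have mD : m = (m1 + (m - m1))%MM by rewrite addmC submK.
    have bin1 : mbin m m1 = 1%N.
      rewrite [X in mbin X _]mD mbin_disjoint // => j.
      rewrite mnmBE m1E; case: eqP => [<-|]; last by left.
      by right; rewrite subnn.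
    have m1_nz : m1 != 0%MM.
      by apply: contraNneq mi => /mnmP/(_ i); rewrite m1E eqxx mnm0E => ->.
    have m2_nz : (m - m1)%MM != 0%MM.
      by apply/eqP => m2_0; apply: m_neq; rewrite {1}mD m2_0 addm0.
    by have /eqP := split_nz _ _ mD m1_nz m2_nz; rewrite bin1 oner_eq0.
  exists i, (m i); split=> //; apply: NNPP => s_npow.
  have s_gt0 : (0 < m i)%N by rewrite lt0n.
  have [l /andP[l_gt0 lt_l] /eqP bin_nz] := bin_neq0_char s_gt0 s_npow.
  have UE k j : (U_(i) *+ k)%MM j = if i == j then k else 0%N.
    by rewrite mulmnE mnm1E; case: eqP; rewrite ?mul1n.
  have U_nz k : (0 < k)%N -> (U_(i) *+ k)%MM != 0%MM.
    by move=> k_gt0; apply/eqP => /mnmP/(_ i); rewrite UE eqxx mnm0E; case: k k_gt0.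
  have mD : m = (U_(i) *+ l + U_(i) *+ (m i - l))%MM.
    rewrite {1}mE; apply/mnmP => j; rewrite mnmDE !UE; case: eqP => // _.
    by rewrite subnKC // ltnW.
  apply: bin_nz; have := split_nz _ _ mD (U_nz _ l_gt0).
  rewrite U_nz ?subn_gt0 // => /(_ isT); rewrite /mbin (bigD1 i) //= big1 ?muln1.
    by rewrite UE eqxx.
  by move=> j /negPf ji; rewrite UE eq_sym ji bin0.
apply: vanishes_distinct_monomials f_van.
  move=> m mf; have [i [s [s_pow mE]]] := powP _ mf; rewrite mE.
  have [|v Tv vi] := R_nz s_pow (i := i); first by rewrite -mE; apply: f_R.
  by exists v => //; rewrite mevalXUn expf_neq0.
move=> m m' mf m'f; have [i [s [s_pow mE]]] := powP _ mf.
have [j [t [t_pow m'E]]] := powP _ m'f => m_neq.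
have [|||v Tv vP] := R_dist s_pow t_pow (i := i) (j := j).
- by rewrite -mE; apply: f_R.
- by rewrite -m'E; apply: f_R.
- by apply: contraNneq m_neq => -[ij st]; rewrite mE m'E ij st.
by exists v => //; rewrite mE m'E !mevalXUn.
Qed.

End Independence.

(** * Generators of the ideal of relations *)

Section GeneratedIdeal.

Variables (R : comNzRingType) (gs : seq R).

Lemma in_ideal0 : in_generated_ideal gs 0.
Proof. by exists (fun=> 0); rewrite big1 // => i _; rewrite mul0r. Qed.

Lemma in_idealD f g :
  in_generated_ideal gs f -> in_generated_ideal gs g ->
  in_generated_ideal gs (f + g).
Proof.
move=> [c ->] [d ->]; exists (fun i => c i + d i); rewrite -big_split.
by apply: eq_bigr => i _; rewrite mulrDl.
Qed.

Lemma in_idealMl a f : in_generated_ideal gs f -> in_generated_ideal gs (a * f).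
Proof.
move=> [c ->]; exists (fun i => a * c i); rewrite mulr_sumr.
by apply: eq_bigr => i _; rewrite mulrA.
Qed.

Lemma in_ideal_mem g : g \in gs -> in_generated_ideal gs g.
Proof.
move=> g_gs; have lt_i : (index g gs < size gs)%N by rewrite index_mem.
exists (fun i => (i == Ordinal lt_i)%:R).
rewrite (bigD1 (Ordinal lt_i)) //= eqxx mul1r nth_index // big1 ?addr0 //.
by move=> i /negPf ->; rewrite mul0r.
Qed.

End GeneratedIdeal.

Lemma in_ideal_meval (K : fieldType) n (gs : seq {mpoly K[n]}) f v :
  (forall g, g \in gs -> g.@[v] = 0) -> in_generated_ideal gs f -> f.@[v] = 0.
Proof.
move=> gs0 [c ->]; rewrite raddf_sum big1 //= => i _.
by rewrite mevalM (gs0 gs`_i) ?mulr0 // mem_nth.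
Qed.

Lemma ex_least (P : nat -> Prop) :
  (exists k, P k) -> exists2 k, P k & forall l, P l -> (k <= l)%N.
Proof.
case=> k; have [d] := ubnP k; elim: d k => // d IH k; rewrite ltnS => le_kd Pk.
have [[l [lt_l Pl]]|H] := classic (exists l, (l < k)%N /\ P l).
  exact: IH (leq_trans lt_l le_kd) Pl.
exists k => // l Pl; rewrite leqNgt; apply/negP => lt_l.
by apply: H; exists l.
Qed.

Section FrobeniusGenerators.

Variables (K : fieldType) (n : nat) (T : ('I_n -> K) -> Prop).

Hypothesis T0 : T (fun=> 0).
Hypothesis TD : forall v w, T v -> T w -> T (fun i => v i + w i).
Hypothesis TM : forall v w, T v -> T w -> T (fun i => v i * w i).

Let power_rel (i j : 'I_n) (s : nat) :=
  char_power K s /\ forall v, T v -> v i = v j ^+ s.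

Let zero_rel (i : 'I_n) := forall v, T v -> v i = 0.

Let covers (U : {set 'I_n}) := forall i, i \notin U ->
  zero_rel i \/ exists u s, u \in U /\ power_rel i u s.

Lemma power_rel_trans i j k s t :
  power_rel i j s -> power_rel j k t -> power_rel i k (t * s).
Proof.
move=> [s_pow ij] [t_pow jk]; split; first exact: char_powerM.
by move=> v Tv; rewrite ij // jk // exprM.
Qed.

Lemma zero_power_rel i j s : power_rel i j s -> zero_rel j -> zero_rel i.
Proof.
move=> [s_pow ij] j0 v Tv; rewrite ij // j0 // expr0n.
by rewrite eqn0Ngt (char_power_gt0 s_pow).
Qed.

(** A member of a minimal [U] that vanishes on [T], or is a power of another
    member, could be removed, since relations compose. *)
Lemma minimal_cover : exists2 U, covers U &
  (forall u, u \in U -> ~ zero_rel u) /\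
  {in U &, forall u w s, u != w -> ~ power_rel u w s}.
Proof.
have [|_ [U [covU <-] minU]] :=
    @ex_least (fun k => exists U, covers U /\ #|U| = k).
  by exists #|[set: 'I_n]|, [set: 'I_n]; split=> // i; rewrite inE.
have noncover u : u \in U -> ~ covers (U :\ u).
  move=> uU covUu; have := minU #|U :\ u| (ex_intro _ _ (conj covUu erefl)).
  by rewrite (cardsD1 u U) uU ltnn.
exists U => //; split=> [u uU u0|u w uU wU s uw u_w]; apply: (noncover _ uU) => i.
  rewrite !inE negb_and negbK; case: eqVneq => [->|_ /= iU]; first by left.
  case: (covU _ iU) => [|[w [s [wU i_w]]]]; first by left.
  have [w_u|w_u] := eqVneq w u; last by right; exists w, s; rewrite !inE w_u.
  by left; apply: zero_power_rel i_w _; rewrite w_u.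
have wUu : w \in U :\ u by rewrite !inE eq_sym uw.
rewrite !inE negb_and negbK; case: eqVneq => [->|_ /= iU].
  by right; exists w, s.
case: (covU _ iU) => [|[x [t [xU i_x]]]]; first by left.
right; have [x_u|x_u] := eqVneq x u; last by exists x, t; rewrite !inE x_u.
by exists w, (s * t)%N; split=> //; apply: power_rel_trans i_x _; rewrite x_u.
Qed.

(** The value [d = 1] encodes that [x_u] satisfies no relation [x_u = x_u ^+ s]
    with [s > 1]; the generator [x_u - x_u ^+ d] is then [0], which is still of
    Frobenius type. *)
Lemma self_exponent u : exists d, power_rel u u d /\
  forall s, (1 < s)%N -> power_rel u u s -> (1 < d <= s)%N.
Proof.
have [|none] := classic (exists s, (1 < s)%N /\ power_rel u u s).
  case/ex_least => d [d_gt1 ud] d_min; exists d; split=> // s s_gt1 us.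
  by rewrite d_gt1 d_min.
exists 1%N; split; first by split=> [|v _]; [exact: char_power1|rewrite expr1].
by move=> s s_gt1 us; case: none; exists s.
Qed.

(** One generator per variable suffices: for [i] in a minimal cover [U] it bounds
    the exponent of [x_i], and for the other [i] it expresses [x_i] by a variable
    in [U]. Modulo them every polynomial has a normal form [NF], whose exponents
    satisfy [R], and on such polynomials vanishing on [T] means being [0]. *)
Theorem frobenius_generators : exists gs : seq {mpoly K[n]},
  [/\ forall g, g \in gs -> frobenius_type K g,
      forall g, g \in gs -> vanishes T g
    & forall f, vanishes T f -> in_generated_ideal gs f].
Proof.
have [U covU [U_nz U_indep]] := minimal_cover.
have [D D_P] := fin_all_exists self_exponent.
have genP i : exists g : {mpoly K[n]},
    [/\ frobenius_type K g, vanishes T g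
      & if i \in U then g = 'X_i - 'X_i ^+ D i else
        g = 'X_i \/ exists u s, u \in U /\ g = 'X_i - 'X_u ^+ s].
  have [iU|iU] := boolP (i \in U).
    have [[D_pow iD] _] := D_P i; exists ('X_i - 'X_i ^+ D i); split=> //.
      by apply: Or32; exists i, (D i).
    by move=> v Tv; rewrite mevalB rmorphXn /= mevalXU -iD // subrr.
  case: (covU _ iU) => [i0|[u [s [uU [s_pow iu]]]]].
    exists 'X_i; split; [by apply: Or31; exists i| |by left].
    by move=> v Tv; rewrite mevalXU i0.
  exists ('X_i - 'X_u ^+ s); split; last by right; exists u, s.
    apply: Or33; exists i, u, s; split=> //.
    by apply: contraNneq iU => <-.
  by move=> v Tv; rewrite mevalB rmorphXn /= !mevalXU iu // subrr.
have {genP} [gen genP] := fin_all_exists genP.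
pose gs := [seq gen i | i <- enum 'I_n].
have gen_gs i : in_generated_ideal gs (gen i).
  by apply: in_ideal_mem; rewrite map_f // mem_enum.
have gs_van g : g \in gs -> vanishes T g.
  by case/mapP => i _ ->; case: (genP i).
exists gs; split=> // [g /mapP [i _ ->]|f f_van]; first by case: (genP i).
pose R (m : 'X_{1..n}) := forall i,
  if i \in U then (1 < D i)%N -> (m i < D i)%N else m i = 0%N.
have R_down m m' : (m <= m')%MM -> R m' -> R m.
  move=> /mnm_lepP le_m Rm' i; have := Rm' i; case: ifP => _.
    by move=> lt_m' /lt_m'; apply: leq_ltn_trans.
  by move=> m'0; have := le_m i; rewrite m'0 leqn0 => /eqP.
have UE i k j : (U_(i) *+ k)%MM j = (if i == j then k else 0)%N.
  by rewrite mulmnE mnm1E; case: eqP; rewrite ?mul1n.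
have R_U i s : char_power K s -> R (U_(i) *+ s)%MM -> i \in U.
  move=> s_pow /(_ i); rewrite UE eqxx; case: ifP => // _ s0.
  by have := char_power_gt0 s_pow; rewrite s0.
have R_nz i s : char_power K s -> R (U_(i) *+ s)%MM -> exists2 v, T v & v i != 0.
  move=> s_pow /(R_U _ _ s_pow) /U_nz i_nz; apply: NNPP => H; apply: i_nz.
  by move=> v Tv; apply/eqP; apply: contraPT H => vi; apply; exists v.
have R_dist i j s t : char_power K s -> char_power K t ->
    R (U_(i) *+ s)%MM -> R (U_(j) *+ t)%MM -> (i, s) != (j, t) ->
    exists2 v, T v & v i ^+ s != v j ^+ t.
  wlog le_st : i j s t / (s <= t)%N.
    move=> W s_pow t_pow Ri Rj neq; case: (leqP s t) => [le_st|/ltnW le_ts].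
      exact: W.
    have [|v Tv vP] := W j i t s le_ts t_pow s_pow Rj Ri; first by rewrite eq_sym.
    by exists v; rewrite // eq_sym.
  move=> s_pow t_pow Ri Rj neq; apply: NNPP => H.
  (* Extracting the [s]-th root leaves a relation [x_i = x_j ^+ r]. *)
  have [r r_pow tE] := char_power_dvd s_pow t_pow le_st.
  have ij_r : power_rel i j r.
    split=> // v Tv; apply: (char_power_inj s_pow).
    rewrite -exprM mulnC -tE; apply/eqP; apply: contraPT H => vP.
    by apply; exists v.
  have iU := R_U _ _ s_pow Ri; have jU := R_U _ _ t_pow Rj.
  have [ij|ij] := eqVneq i j; last exact: (U_indep i j iU jU r ij).
  move: ij_r neq Rj; rewrite -ij xpair_eqE eqxx /= => ii_r s_t Rj.
  have r_gt1 : (1 < r)%N.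
    rewrite ltn_neqAle (char_power_gt0 r_pow) andbT.
    by apply: contraNneq s_t => r1; rewrite tE -r1 muln1.
  have /andP[D_gt1 D_le] := (D_P i).2 _ r_gt1 ii_r.
  have := Rj i; rewrite iU UE eqxx => /(_ D_gt1); rewrite ltnNge.
  by rewrite (leq_trans D_le) // tE leq_pmull ?(char_power_gt0 s_pow).
pose NF (g : {mpoly K[n]}) := exists2 h, supported R h & in_generated_ideal gs (g - h).
have NF_congr g h : in_generated_ideal gs (g - h) -> NF h -> NF g.
  move=> gh [k Rk hk]; exists k => //.
  by rewrite -(subrK h g) -addrA; apply: in_idealD.
have NF0 : NF 0.
  exists 0; last by rewrite subrr; apply: in_ideal0.
  by move=> m; rewrite mcoeff_msupp mcoeff0 eqxx.
have NFD g h : NF g -> NF h -> NF (g + h).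
  move=> [g' Rg gg'] [h' Rh hh']; exists (g' + h').
    by move=> m /msuppD_le; rewrite mem_cat => /orP[/Rg|/Rh].
  by rewrite opprD addrACA; apply: in_idealD.
have NFZ c g : NF g -> NF (c *: g).
  move=> [g' Rg gg']; exists (c *: g'); first by move=> m /msuppZ_le /Rg.
  by rewrite -scalerBr -mul_mpolyC; apply: in_idealMl.
have NFX m : R m -> NF 'X_[m].
  move=> Rm; exists 'X_[m]; first by move=> m' /mem_msuppXP <-.
  by rewrite subrr; apply: in_ideal0.
have NF_mulU u g : u \in U -> NF g -> NF ('X_u * g).
  move=> uU [h Rh gh]; apply: (NF_congr _ ('X_u * h)).
    by rewrite -mulrBr; apply: in_idealMl.
  rewrite [h]mpolyE mulr_sumr big_seq.
  elim/big_ind: _ => // m /Rh Rm.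
  rewrite -scalerAr -mpolyXD; apply: NFZ.
  have [[D_gt1 mD]|small] := classic ((1 < D u)%N /\ (m u).+1 = D u); last first.
    apply: NFX => i; rewrite mnmDE mnm1E; have := Rm i.
    have [<-|_] := eqVneq u i; last by rewrite add0n.
    rewrite uU add1n => lt_m D_gt1; rewrite ltn_neqAle lt_m // andbT.
    by apply/eqP => mD; apply: small.
  (* The exponent of [x_u] has reached [D u], so it drops to [1]. *)
  pose m' := (m - U_(u) *+ m u)%MM.
  have m'E i : m' i = (if u == i then 0 else m i)%N.
    by rewrite mnmBE UE; case: eqP => [->|_]; rewrite ?subnn ?subn0.
  have mE : (U_(u) + m = U_(u) *+ D u + m')%MM.
    apply/mnmP => i; rewrite !mnmDE m'E UE mnm1E; case: eqP => [<-|_] //.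
    by rewrite add1n addn0 mD.
  apply: (NF_congr _ 'X_[U_(u) + m']).
    rewrite mE !mpolyXD -mulrBl mulrC; apply: in_idealMl.
    have [_ _] := genP u; rewrite uU mpolyXn => gE.
    have := in_idealMl (-1) (gen_gs u).
    by rewrite gE mulN1r opprB.
  apply: NFX => i; rewrite mnmDE m'E mnm1E; have := Rm i.
  by have [<-|_] := eqVneq u i; rewrite ?uU.
have NF_mulX i g : NF g -> NF ('X_i * g).
  move=> NFg; have [iU|iU] := boolP (i \in U); first exact: NF_mulU.
  have [_ _] := genP i; rewrite (negPf iU) => -[gE|[u [s [uU gE]]]].
    apply: (NF_congr _ 0) => //.
    by rewrite subr0 mulrC; apply: in_idealMl; rewrite -gE.
  apply: (NF_congr _ ('X_u ^+ s * g)).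
    by rewrite -mulrBl mulrC; apply: in_idealMl; rewrite -gE.
  elim: s {gE} => [|s IH]; first by rewrite mul1r.
  by rewrite exprS -mulrA; apply: NF_mulU.
have NF_all g : NF g.
  elim/mpolyind: g => // c m g _ _ NFg; apply: NFD => //; apply: NFZ.
  rewrite mpolyXE_id; apply: big_rec => [|i h _ NFh].
    by rewrite -mpolyX0; apply: NFX => i; rewrite mnm0E; case: ifP => // _ /ltnW.
  elim: (m i) => [|k IH]; first by rewrite mul1r.
  by rewrite exprS -mulrA; apply: NF_mulX.
have [g Rg fg] := NF_all f.
have g_van : vanishes T g.
  move=> v Tv; have := in_ideal_meval (fun h h_gs => gs_van h h_gs v Tv) fg.
  by rewrite mevalB f_van // sub0r => /eqP; rewrite oppr_eq0 => /eqP.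
have g0 : g = 0 by apply: (vanishes_supported_eq0 TM T0 TD R_down).
by move: fg; rewrite g0 subr0.
Qed.

End FrobeniusGenerators.

(** * Idempotents and nilpotents in a finite dimensional algebra *)

Definition nilpotent (R : pzRingType) (x : R) := exists k, x ^+ k = 0.

Definition primitive_idempotent (R : pzRingType) (e : R) :=
  [/\ e != 0, e * e = e
    & forall f, f * f = f -> f * e = f -> f = 0 \/ f = e].

Section CommutativeRing.

Variable R : comNzRingType.
Implicit Types (x y e f : R).

Lemma nilpotentD x y : nilpotent x -> nilpotent y -> nilpotent (x + y).
Proof.
move=> [a xa] [b yb]; exists (a + b)%N; rewrite exprDn big1 // => i _.
case: (leqP b i) => [le_b|/ltnW le_i].
  by rewrite -(subnK le_b) exprD yb !mulr0 mul0rn.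
by rewrite -addnBA // exprD xa !mul0r mul0rn.
Qed.

Lemma nilpotentM x y : nilpotent x -> nilpotent (y * x).
Proof. by move=> [a xa]; exists a; rewrite exprMn xa mulr0. Qed.

(** A relation [y ^+ k = y ^+ k.+1 * z] gives [y ^+ k = y ^+ (k + k) * z ^+ k],
    so that [y ^+ k * z ^+ k * e] is idempotent; if it is [0] then [y] is
    nilpotent, and if it is [e] then [y] is invertible in [e * R]. *)
Lemma primitive_fitting e y z k : primitive_idempotent e -> y * e = y ->
  y ^+ k = y ^+ k.+1 * z -> nilpotent y \/ exists w, y * w = e.
Proof.
move=> [_ ee e_prim] ye yk.
have ykj j : y ^+ k = y ^+ (k + j) * z ^+ j.
  elim: j => [|j IH]; first by rewrite addn0 mulr1.
  have -> : z ^+ j.+1 = z * z ^+ j by rewrite exprS.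
  by rewrite {1}IH mulrA; congr (_ * _); rewrite addnS -addSn !exprD mulrAC -yk.
pose f := y ^+ k * z ^+ k * e.
have yk_f : y ^+ k * e = y ^+ k * f.
  by rewrite {1}(ykj k) exprD /f !mulrA.
have ff : f * f = f.
  have -> : f * f = y ^+ k * f * (z ^+ k * e).
    have swap (a b c d : R) : a * b * c * d = a * d * (b * c) by ring.
    by rewrite {1}/f swap.
  by rewrite -yk_f /f mulrACA ee.
have fe : f * e = f by rewrite /f -mulrA ee.
have [f0|fE] := e_prim f ff fe.
  by left; exists k.+1; rewrite exprSr -{2}ye mulrCA yk_f f0 !mulr0.
right; move: fE; rewrite /f => {ykj f yk_f ff fe}; case: k yk => [|k] yk fE.
  exists (z * e); rewrite mulrA; move: yk; rewrite expr0 expr1 => <-.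
  by rewrite mul1r.
by exists (y ^+ k * z ^+ k.+1 * e); rewrite !mulrA -exprS.
Qed.

End CommutativeRing.

Section SplitAlgebra.

Variables (K : fieldType) (R : comAlgType K).
Implicit Types (x y e f : R).

Hypothesis splitR : forall x, exists r : seq K, \prod_(c <- r) (x - c%:A) = 0.

(** The factors with [c = 0] contribute the power of [y], the others the
    invertible constant term [a]. *)
Lemma prod_subE y (r : seq K) : exists k (a : K) z, a != 0 /\
  \prod_(c <- r) (y - c%:A) = y ^+ k * (a%:A + y * z).
Proof.
elim: r => [|c r [k [a [z [a_nz IH]]]]].
  exists 0%N, 1, 0; rewrite oner_neq0; split=> //.
  by rewrite big_nil mulr0 addr0 scale1r mulr1.
rewrite big_cons IH; have [->|c_nz] := eqVneq c 0.
  by exists k.+1, a, z; split=> //; rewrite scale0r subr0 mulrA exprS.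
exists k, (- c * a), (a%:A - c *: z + y * z); split.
  by rewrite mulf_neq0 ?oppr_eq0.
rewrite mulrCA; congr (_ * _).
rewrite -[c *: z]mulr_algl mulNr scaleNr -scalerA -[c *: a%:A]mulr_algl.
by ring.
Qed.

Lemma primitive_or e y : primitive_idempotent e -> y * e = y ->
  nilpotent y \/ exists w, y * w = e.
Proof.
move=> e_prim ye; have [r yr] := splitR y.
have [k [a [z [a_nz rE]]]] := prod_subE y r.
apply: (primitive_fitting (z := - a^-1 *: z) (k := k)) => //.
have : y ^+ k * a%:A + y ^+ k.+1 * z = 0.
  by rewrite exprSr -mulrA -mulrDr -rE.
move/eqP; rewrite addr_eq0 mulr_algr => /eqP /(congr1 (fun u => a^-1 *: u)).
by rewrite scalerA mulVf // scale1r => ->; rewrite -scalerAr scaleNr scalerN.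
Qed.

(** Some root [c] of a polynomial that annihilates [x] must be an eigenvalue: if
    every [(x - c) * e] were invertible in [e * R], then so would be their
    product, which is [0]. *)
Lemma primitive_eigenvalue e x : primitive_idempotent e ->
  exists c : K, nilpotent (x * e - c *: e).
Proof.
move=> e_prim; have [e_nz ee _] := e_prim.
have [r xr] := splitR x; apply: NNPP => H.
have inv c : exists w, (x - c%:A) * w = e.
  have [|xc_nil|[w wE]] := @primitive_or e ((x - c%:A) * e) e_prim.
  - by rewrite -mulrA ee.
  - by case: H; exists c; move: xc_nil; rewrite mulrBl mulr_algl.
  by exists (e * w); rewrite mulrA.
have [w wE] : exists w, \prod_(c <- r) (x - c%:A) * w = e.
  elim: (r) => [|c s [w IH]]; first by exists e; rewrite big_nil mul1r.
  have [w' w'E] := inv c; exists (w' * w).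
  by rewrite big_cons mulrACA w'E IH ee.
by case/eqP: e_nz; rewrite -wE xr mul0r.
Qed.

End SplitAlgebra.

(** A subspace of maximal dimension among those contained in [P] is all of [P]. *)
Lemma vspace_of_pred (K : fieldType) (vT : vectType K) (P : vT -> Prop) :
  P 0 -> (forall x y, P x -> P y -> P (x + y)) ->
  (forall c x, P x -> P (c *: x)) ->
  exists V : {vspace vT}, forall x, x \in V <-> P x.
Proof.
move=> P0 PD PZ.
pose sub (V : {vspace vT}) := forall x, x \in V -> P x.
have [|_ [V [subV <-] V_max]] := @ex_least
    (fun k => exists V, sub V /\ \dim {:vT} - \dim V = k)%N.
  exists (\dim {:vT} - \dim (0%VS : {vspace vT}))%N, 0%VS; split=> // x.
  by rewrite memv0 => /eqP ->.
exists V => x; split=> [/subV //|Px].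
have subVx : sub (V + <[x]>)%VS.
  move=> _ /memv_addP [u uV [v /vlineP [c ->] ->]].
  by apply: PD; [apply: subV|apply: PZ].
have := V_max _ (ex_intro _ _ (conj subVx erefl)).
have le_dim := dimvS (subvf (V + <[x]>)).
rewrite leq_sub2lE // => le_V.
have := dimv_leqif_sup (addvSl V <[x]>); rewrite /leqif => -[le_Vx].
by rewrite eqn_leq le_Vx le_V => /esym; rewrite subv_add -memvE => /andP[].
Qed.

Lemma adapted_basis (K : fieldType) (vT : vectType K) (U V : {vspace vT})
    (X : seq vT) :
  (U + V)%VS = fullv -> directv (U + V) -> basis_of U X ->
  exists2 b : (\dim {:vT}).-tuple vT, basis_of {:vT} b &
    forall i : 'I_(\dim {:vT}), if (i < size X)%N then b`_i = X`_i else b`_i \in V.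
Proof.
move=> UV dirUV basX; have basY := vbasisP V.
have := cat_basis dirUV basX basY; rewrite UV => basXY.
have sizeXY : size (X ++ vbasis V) == \dim {:vT}.
  by rewrite (size_basis (X := in_tuple _) basXY).
exists (Tuple sizeXY) => [//|i /=].
rewrite nth_cat; case: ltnP => // le_i; apply: (basis_mem basY).
rewrite mem_nth // ltn_subLR // -size_cat (eqP sizeXY).
exact: ltn_ord.
Qed.

(** [B] with its commutativity packed into the structure, so that statements
    about commutative rings apply to it. *)
Definition com_alg_of (K : fieldType) (B : algType K)
    (B_comm : commutative (@GRing.mul B)) : comAlgType K :=
  HB.pack (GRing.Algebra.sort B) (GRing.PzRing_hasCommutativeMul.Build B B_comm).

Section SplitFalg.

Variables (K : closedFieldType) (B : falgType K).

(** The powers of [x] are linearly dependent, and the polynomial that this gives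
    splits over [K]. *)
Lemma falg_split (x : B) : exists r : seq K, \prod_(c <- r) (x - c%:A) = 0.
Proof.
pose X := [tuple x ^+ i | i < (\dim {:B}).+1].
have XE (j : 'I_(\dim {:B}).+1) : X`_j = x ^+ j by rewrite -tnth_nth tnth_mktuple.
have [k [k0 [i ki]]] : exists k : 'I_(\dim {:B}).+1 -> K,
    \sum_i k i *: X`_i = 0 /\ exists i, k i != 0.
  apply: NNPP => H; have : free X.
    apply/freeP => k k0 i; apply/eqP; apply: contraPT H => ki; apply.
    by exists k; split=> //; exists i.
  rewrite /free size_tuple => /eqP dimX.
  by have := dimvS (subvf <<X>>); rewrite dimX ltnn.
pose p := \poly_(j < (\dim {:B}).+1) k (inord j).
have p_nz : p != 0.
  apply: contraNneq ki => p0; have := congr1 (fun q : {poly K} => q`_i) p0.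
  by rewrite coef_poly ltn_ord inord_val coef0 => ->.
have px : horner_alg x p = 0.
  rewrite -[RHS]k0 /p poly_def rmorph_sum /=; apply: eq_bigr => j _.
  rewrite linearZ /= rmorphXn /= horner_algX inord_val.
  by rewrite XE mulr_algl.
have [r pE] := closed_field_poly_normal p; exists r.
move: px; rewrite pE linearZ /= rmorph_prod /= mulr_algl => /eqP.
rewrite scaler_eq0 lead_coef_eq0 (negPf p_nz) /= => /eqP <-.
by apply: eq_bigr => c _; rewrite rmorphB /= horner_algX horner_algC.
Qed.

Hypothesis B_comm : commutative (@GRing.mul B).

Definition orthogonal_idempotents (s : seq B) :=
  [/\ uniq s, forall e, e \in s -> e != 0 /\ e * e = e,
      {in s &, forall e f, e != f -> e * f = 0}
    & \sum_(e <- s) e = 1].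

Lemma orthogonal_mul_sum s (k : B -> K) e : orthogonal_idempotents s -> e \in s ->
  (\sum_(f <- s) k f *: f) * e = k e *: e.
Proof.
move=> [s_uniq s_idem s_orth _] es; rewrite mulr_suml (bigD1_seq e) //=.
rewrite -scalerAl (s_idem _ es).2 big_seq_cond big1 ?addr0 // => f /andP[fs fe].
by rewrite -scalerAl s_orth // scaler0.
Qed.

Lemma orthogonal_free s : orthogonal_idempotents s -> free s.
Proof.
move=> s_orth; have [s_uniq s_idem _ _] := s_orth.
change (is_true (free (in_tuple s))); apply/freeP => k k0 i.
have lt_i := ltn_ord i; have si : s`_i \in s by rewrite mem_nth.
have kE f : f \in s -> exists2 j : 'I_(size s), s`_j = f & index f s = j.
  move=> fs; have lt_f : (index f s < size s)%N by rewrite index_mem.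
  by exists (Ordinal lt_f); rewrite //= nth_index.
pose k' f := if insub (index f s) is Some j then k j else 0.
have sumE : \sum_(f <- s) k' f *: f = 0.
  rewrite -[RHS]k0 (big_nth 0) big_mkord; apply: eq_bigr => j _.
  by rewrite /k' index_uniq // valK.
have := orthogonal_mul_sum k' s_orth si.
rewrite sumE mul0r /k' index_uniq // valK => /esym/eqP.
by rewrite scaler_eq0 (negPf (s_idem _ si).1) orbF => /eqP.
Qed.

(** A complete family of nonzero orthogonal idempotents is free, so there is one
    of maximal length; it cannot be refined, so its members are primitive. *)
Lemma primitive_decomposition : exists2 s, orthogonal_idempotents s &
  forall e, e \in s -> primitive_idempotent e.
Proof.
have dim_le s : orthogonal_idempotents s -> (size s <= \dim {:B})%N.
  by move/orthogonal_free/eqnP => <-; rewrite dimvS ?subvf.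
have [|_ [s [s_orth <-]] s_max] := @ex_least
    (fun k => exists s, orthogonal_idempotents s /\ \dim {:B} - size s = k)%N.
  exists (\dim {:B} - size [:: 1%R : B])%N, [:: 1]; split=> //; split=> //.
  - by move=> e; rewrite inE => /eqP ->; rewrite oner_neq0 mulr1.
  - by move=> e f; rewrite !inE => /eqP -> /eqP ->; rewrite eqxx.
  by rewrite big_seq1.
exists s => // e es; have [s_uniq s_idem s_ortho s_sum] := s_orth.
have [e_nz ee] := s_idem _ es; split=> // f ff fe; apply: NNPP => H.
have f_nz : f != 0 by apply/eqP => f0; apply: H; left.
have ef_nz : e - f != 0.
  by rewrite subr_eq0; apply/eqP => ef; apply: H; right.
have ef : e * f = f by rewrite B_comm.
have fef : f * (e - f) = 0 by rewrite mulrBr fe ff subrr.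
pose s' := rem e s; have s'P g : g \in s' -> g \in s /\ e * g = 0.
  rewrite (mem_rem_uniq _ s_uniq) !inE => /andP[ge gs]; split=> //.
  by rewrite s_ortho // eq_sym.
have fs' g : g \in s' -> f * g = 0.
  by case/s'P => _ eg; rewrite -fe -mulrA eg mulr0.
have efs' g : g \in s' -> (e - f) * g = 0.
  by move=> gs'; rewrite mulrBl fs' // (s'P _ gs').2 subrr.
have t_orth : orthogonal_idempotents [:: f, e - f & s'].
  split.
  - rewrite /= inE negb_or rem_uniq // andbT -andbA; apply/and3P; split.
    + by apply: contraNneq f_nz => fE; rewrite -ff {2}fE fef.
    + by apply: contra f_nz => /fs'; rewrite ff => ->.
    apply: contra ef_nz => /efs'; rewrite mulrBl mulrBr ee ef fef subr0.
    by move=> ->.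
  - move=> g; rewrite !inE => /or3P[/eqP ->|/eqP ->|/s'P [gs _]]; first by [].
      by split=> //; rewrite mulrBl mulrBr ee ef fef subr0.
    exact: s_idem.
  - move=> g h; rewrite !inE.
    case/or3P => [/eqP ->|/eqP ->|gs'] /or3P[/eqP ->|/eqP ->|hs'] //.
    + by rewrite eqxx.
    + by rewrite fs'.
    + by rewrite B_comm fef.
    + by rewrite eqxx.
    + by rewrite efs'.
    + by rewrite B_comm fs'.
    + by rewrite B_comm efs'.
    by apply: s_ortho; [case: (s'P _ gs')|case: (s'P _ hs')].
  by rewrite !big_cons addrA [f + _]addrC subrK -s_sum [RHS](big_rem e) //.
have := s_max _ (ex_intro _ _ (conj t_orth erefl)).
rewrite leq_sub2lE ?dim_le //= size_rem // prednK; last by case: (s) es.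
by rewrite ltnn.
Qed.

(** Each [x * e], with [e] primitive, is a multiple of [e] up to a nilpotent
    element, so the idempotents and the nilpotents span [B]; the sum is direct
    because multiplying a combination of the idempotents by [e] isolates the
    coefficient of [e]. *)
Lemma idempotent_nilpotent_basis :
  exists (b : (\dim {:B}).-tuple B) (I : {set 'I_(\dim {:B})}),
  [/\ basis_of {:B} b, forall i, i \in I -> b`_i * b`_i = b`_i,
      forall i j, i \in I -> j \in I -> i != j -> b`_i * b`_j = 0
    & forall i, i \notin I -> nilpotent b`_i].
Proof.
have [s s_orth s_prim] := primitive_decomposition.
have [s_uniq s_idem s_ortho s_sum] := s_orth.
have nilZ (c : K) (x : B) : nilpotent x -> nilpotent (c *: x).
  by move=> [k xk]; exists k; rewrite exprZn xk scaler0.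
have nilM (y x : B) : nilpotent x -> nilpotent (y * x).
  exact: (@nilpotentM (com_alg_of B_comm)).
have [N NP] := @vspace_of_pred K B (@nilpotent B) (ex_intro _ 1%N (expr1 0))
  (@nilpotentD (com_alg_of B_comm)) nilZ.
have NU : (<<s>> + N)%VS = fullv.
  apply/eqP; rewrite eqEsubv subvf; apply/subvP => x _.
  rewrite -[x]mulr1 -s_sum mulr_sumr big_seq rpred_sum // => e es.
  have [c c_nil] := @primitive_eigenvalue K (com_alg_of B_comm) falg_split
    e x (s_prim _ es).
  rewrite -[x * e](subrK (c *: e)) addrC memv_add //.
    by rewrite memvZ // memv_span.
  exact/NP.
have dirNU : directv (<<s>> + N).
  apply/directv_addP/eqP; rewrite -subv0; apply/subvP => x /memv_capP [xs xN].
  have [k xE _] := free_span (orthogonal_free s_orth) xs.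
  rewrite memv0 xE big_seq big1 // => e es.
  have := nilM e _ (proj1 (NP x) xN).
  rewrite B_comm xE (orthogonal_mul_sum _ s_orth es) => -[l].
  rewrite exprZn => /eqP; rewrite scaler_eq0.
  have eX : e ^+ l != 0.
    have [e_nz ee] := s_idem _ es; case: l => [|l]; first by rewrite oner_neq0.
    suff -> : e ^+ l.+1 = e by [].
    by elim: l => [|l IH]; rewrite ?expr1 // exprS IH.
  by rewrite (negPf eX) orbF expf_eq0 => /andP[_ /eqP ->]; rewrite scale0r.
have bas_s : basis_of <<s>> s by rewrite /basis_of eqxx orthogonal_free.
have [b bas_b bP] := adapted_basis NU dirNU bas_s.
exists b, [set i : 'I_(\dim {:B}) | (i < size s)%N].
have bs (i : 'I_(\dim {:B})) : (i < size s)%N -> b`_i = s`_i.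
  by move=> lt_i; have := bP i; rewrite lt_i.
split=> // [i|i j|i]; rewrite !inE.
- by move=> lt_i; rewrite bs // (s_idem _ (mem_nth 0 lt_i)).2.
- move=> lt_i lt_j ij; rewrite !bs // s_ortho ?mem_nth //.
  by rewrite nth_uniq.
by move=> /negPf le_i; apply/NP; have := bP i; rewrite le_i.
Qed.

End SplitFalg.

Lemma char_power_expr_sum (R : comNzRingType) s (I : finType) (P : pred I)
    (F : I -> R) : char_power R s ->
  (\sum_(i | P i) F i) ^+ s = \sum_(i | P i) F i ^+ s.
Proof.
move=> s_pow; elim/big_rec2: _ => [|i x y _ <-].
  by rewrite expr0n gtn_eqF ?(char_power_gt0 s_pow).
by rewrite char_power_exprD.
Qed.

Lemma char_power_eq (R S : nzRingType) s :
  [pchar R] =i [pchar S] -> char_power R s <-> char_power S s.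
Proof. by move=> RS; rewrite !char_powerE (eq_pnat _ RS). Qed.

(** The coefficients of a Frobenius relation lie in the prime field, so they are
    fixed by the [s]-th power map. *)
Lemma frobenius_type_meval_expr (K : fieldType) n (f : {mpoly K[n]}) s v :
  char_power K s -> frobenius_type K f ->
  f.@[fun i => v i ^+ s] = f.@[v] ^+ s.
Proof.
move=> s_pow [[i ->]|[i [t [_ ->]]]|[i [j [t [_ _ ->]]]]].
- by rewrite !mevalXU.
- by rewrite !mevalB !rmorphXn /= !mevalXU char_power_exprB // exprAC.
by rewrite !mevalB !rmorphXn /= !mevalXU char_power_exprB // exprAC.
Qed.

(** * Coordinates of a subalgebra *)

Section Coordinates.

Variables (K : fieldType) (B : falgType K).
Let n := \dim {:B}.
Implicit Types (b : n.-tuple B) (A : B -> Prop) (f : {mpoly K[n]}).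

Definition coords b A : ('I_n -> K) -> Prop :=
  fun v => exists2 a, A a & v =1 (fun i => coord b i a).

Lemma pol_vanishes b A f : pol b A f <-> vanishes (coords b A) f.
Proof.
split=> [f_pol v [a Aa vE]|f_van a Aa].
  by rewrite (meval_eq f vE); apply: f_pol.
by apply: f_van; exists a.
Qed.

(** A change of base is a linear substitution of the variables. *)
Lemma zariski_closed_basis b0 b A : basis_of {:B} b ->
  zariski_closed b0 A -> zariski_closed b A.
Proof.
move=> b_bas [S AS].
pose lq := [tuple \sum_(j < n) coord b0 i b`_j *: ('X_j : {mpoly K[n]}) | i < n].
have lqE f x : mpoly_fun b (f \mPo lq) x = mpoly_fun b0 f x.
  rewrite /mpoly_fun comp_mpoly_meval; apply: meval_eq => i.
  rewrite tnth_mktuple raddf_sum /= [in RHS](coord_basis b_bas (memvf x)).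
  rewrite linear_sum /=; apply: eq_bigr => j _.
  by rewrite mevalZ mevalXU linearZ /= mulrC.
exists (fun g => exists2 f, S f & g = f \mPo lq) => x.
rewrite AS; split=> [H _ [f Sf ->]|H f Sf]; first by rewrite lqE H.
by rewrite -lqE; apply: H; exists f.
Qed.

(** The characteristics of [F] and [K] agree, so the Frobenius relations are the
    same over both fields. *)
Lemma pol_frobenius_generators (F : fieldType) (iota : {rmorphism F -> K}) b A :
  coords b A (fun=> 0) ->
  (forall v w, coords b A v -> coords b A w -> coords b A (fun i => v i + w i)) ->
  (forall v w, coords b A v -> coords b A w -> coords b A (fun i => v i * w i)) ->
  exists gs : seq {mpoly K[n]},
    (forall g, g \in gs -> frobenius_type F g) /\
    (forall f, pol b A f <-> in_generated_ideal gs f).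
Proof.
move=> A0 AD AM; have [gs [gs_frob gs_van gs_gen]] := frobenius_generators A0 AD AM.
have powF s : char_power K s -> char_power F s.
  by move/(char_power_eq _ (fmorph_pchar iota)).
exists gs; split=> [g /gs_frob|f].
  case=> [[i ->]|[i [s [/powF s_pow ->]]]|[i [j [s [ji /powF s_pow ->]]]]].
  - by apply: Or31; exists i.
  - by apply: Or32; exists i, s.
  by apply: Or33; exists i, j, s.
rewrite pol_vanishes; split=> [/gs_gen //|f_gs v Av].
by apply: in_ideal_meval f_gs => g /gs_van; apply.
Qed.

End Coordinates.

(** * Closed semiprime subalgebras *)

Section Subalgebra.

Variables (F : fieldType) (K : closedFieldType) (iota : {rmorphism F -> K}).
Variable B : falgType K.
Hypothesis B_comm : commutative (@GRing.mul B).
Let n := \dim {:B}.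
Variables (b0 : n.-tuple B) (A : B -> Prop).
Hypotheses (A_subalg : is_subalg iota A) (A_semiprime : semiprime iota A).
Hypothesis A_closed : zariski_closed b0 A.

Let A0 : A 0. Proof. by case: A_subalg => -[]. Qed.

Let AD x y : A x -> A y -> A (x + y).
Proof. by case: A_subalg => -[_ + _] _; apply. Qed.

Let AZ c x : A x -> A (iota c *: x).
Proof. by case: A_subalg => -[_ _ +] _; apply. Qed.

Let AM x y : A x -> A y -> A (x * y).
Proof. by case: A_subalg => _; apply. Qed.

Let AB x y : A x -> A y -> A (x - y).
Proof.
move=> Ax /(AZ (-1)) Ay; rewrite -[- y]scaleN1r; apply: AD => //.
by rewrite -(rmorph1 iota) -rmorphN.
Qed.

Lemma semiprime_square0 x : A x -> x * x = 0 -> x = 0.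
Proof.
move=> Ax xx.
(* The ideal generated by [x] is [F x + A x], as [A] may lack a unit. *)
pose I y := exists c a, A a /\ y = iota c *: x + a * x.
apply: (A_semiprime (I := I)).
- split; first split.
  + by exists 0, 0; rewrite rmorph0 scale0r mul0r addr0.
  + move=> _ _ [c [a [Aa ->]]] [d [e [Ae ->]]]; exists (c + d), (a + e).
    by split; [exact: AD|rewrite rmorphD scalerDl mulrDl addrACA].
  + move=> d _ [c [a [Aa ->]]]; exists (d * c), (iota d *: a).
    by split; [exact: AZ|rewrite rmorphM -scalerA scalerDr -scalerAl].
  + by move=> _ [c [a [Aa ->]]]; apply: AD; [exact: AZ|exact: AM].
  move=> d _ Ad [c [a [Aa ->]]]; rewrite [_ * d]B_comm.
  suff Idx : I (d * (iota c *: x + a * x)) by [].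
  exists 0, (iota c *: d + d * a); split; first by apply: AD; [exact: AZ|exact: AM].
  by rewrite rmorph0 scale0r add0r mulrDr mulrDl -scalerAr -scalerAl mulrA.
- exists 2 => y Iy; rewrite !big_ord_recl big_ord0 mulr1.
  have [c [a [_ ->]]] := Iy ord0; have [d [e [_ ->]]] := Iy (lift ord0 ord0).
  have multE (c' : K) a' : c' *: x + a' * x = (c'%:A + a') * x.
    by rewrite mulrDl mulr_algl.
  by rewrite !multE -mulrA [x * (_ * x)]B_comm -mulrA xx !mulr0.
by exists 1, 0; rewrite rmorph1 scale1r mul0r addr0.
Qed.

Lemma semiprime_reduced x : A x -> nilpotent x -> x = 0.
Proof.
move=> Ax [k]; have [d] := ubnP k; elim: d k x Ax => // d IH [|[|k]] x Ax.
- by rewrite expr0 => _ /eqP; rewrite oner_eq0.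
- by rewrite expr1.
rewrite ltnS => le_k xk; apply: semiprime_square0 => //.
apply: (IH k.+1) => //; first exact: AM.
have kE : (2 * k.+1 = k.+2 + k)%N by rewrite mul2n -addnn !addSn addnS.
by rewrite -expr2 -exprM kE exprD xk mul0r.
Qed.

Section Characteristic.

Variables (b : n.-tuple B) (I : {set 'I_n}) (q : nat).
Hypotheses (b_basis : basis_of {:B} b) (q_pow : char_power K q).
Hypotheses (b_idem : forall i, i \in I -> b`_i * b`_i = b`_i)
  (b_orth : forall i j, i \in I -> j \in I -> i != j -> b`_i * b`_j = 0)
  (b_nil : forall i, i \notin I -> b`_i ^+ q = 0).

Let part (v : 'I_n -> K) := \sum_(i in I) v i *: b`_i.

Let coord_part v i : coord b i (part v) = if i \in I then v i else 0.
Proof.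
have -> : part v = \sum_(j < n) (if j \in I then v j else 0) *: b`_j.
  rewrite /part big_mkcond; apply: eq_bigr => j _.
  by case: ifP => // _; rewrite scale0r.
by rewrite coord_sum_free // (basis_free b_basis).
Qed.

Let part_mul v w : part v * part w = part (fun i => v i * w i).
Proof.
rewrite /part mulr_suml; apply: eq_bigr => i iI.
rewrite mulr_sumr (bigD1 i) //= big1 ?addr0.
  by rewrite -scalerAl -scalerAr scalerA b_idem.
move=> j /andP[jI ji]; rewrite -scalerAl -scalerAr b_orth ?scaler0 //.
by rewrite eq_sym.
Qed.

(** The [q]-th power map is additive, fixes the idempotents of the base and kills
    its nilpotents. *)
Lemma power_part x : x ^+ q = part (fun i => coord b i x ^+ q).
Proof.
rewrite {1}(coord_basis b_basis (memvf x)).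
have q_powB : char_power (com_alg_of B_comm) q.
  by apply/(char_power_eq _ (pchar_lalg (com_alg_of B_comm))).
rewrite [LHS](@char_power_expr_sum (com_alg_of B_comm)) //.
rewrite /part [RHS]big_mkcond; apply: eq_bigr => i _.
rewrite exprZn; case: ifP => [iI|/negbT iI]; last by rewrite b_nil // scaler0.
congr (_ *: _); have: (0 < q)%N := char_power_gt0 q_pow.
case: (q) => // k _; elim: k => [|k IH]; first by rewrite expr1.
by rewrite exprS IH b_idem.
Qed.

(** Both sides have the same [q]-th power, which can be computed in the span of
    the idempotents. *)
Lemma coord_mul x y i : i \in I -> coord b i (x * y) = coord b i x * coord b i y.
Proof.
move=> iI; apply: (char_power_inj q_pow).
have := congr1 (coord b i) (power_part (x * y)).
rewrite [LHS](_ : _ = coord b i (x ^+ q * y ^+ q)); last first.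
  by rewrite exprMn_comm //; apply: B_comm.
rewrite !power_part part_mul !coord_part iI => <-.
by rewrite exprMn.
Qed.

Let semisimple_coords (v : 'I_n -> K) :=
  exists2 a, A a & v =1 (fun i => if i \in I then coord b i a else 0).

Let semisimple_coords0 : semisimple_coords (fun=> 0).
Proof. by exists 0 => // i; rewrite linear0 if_same. Qed.

Let semisimple_coordsD v w :
  semisimple_coords v -> semisimple_coords w ->
  semisimple_coords (fun i => v i + w i).
Proof.
move=> [a Aa vE] [c Ac wE]; exists (a + c); first exact: AD.
by move=> i; rewrite vE wE linearD /=; case: ifP => // _; rewrite addr0.
Qed.

Let semisimple_coordsM v w :
  semisimple_coords v -> semisimple_coords w ->
  semisimple_coords (fun i => v i * w i).
Proof.
move=> [a Aa vE] [c Ac wE]; exists (a * c); first exact: AM.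
move=> i; rewrite vE wE; case: ifP => [/coord_mul -> //|_].
by rewrite mul0r.
Qed.

(** [T] is the set of coordinate vectors of the [a ^+ q] with [a] in [A]. The
    Frobenius relations that hold on [T] hold, by extraction of [q]-th roots, for
    the components [s] of the elements of [A] along the idempotents. So each [s]
    satisfies the equations of the closed set [A], and [a - s] is a nilpotent
    element of [A]. *)
Lemma A_semisimple a : A a -> a = part (fun i => coord b i a).
Proof.
pose T v := exists2 w, semisimple_coords w & v =1 (fun i => w i ^+ q).
have T0 : T (fun=> 0).
  exists (fun=> 0) => // i.
  by rewrite expr0n gtn_eqF ?(char_power_gt0 q_pow).
have TD v w : T v -> T w -> T (fun i => v i + w i).
  move=> [v' Tv vE] [w' Tw wE]; exists (fun i => v' i + w' i).
    exact: semisimple_coordsD.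
  by move=> i; rewrite vE wE char_power_exprD.
have TM v w : T v -> T w -> T (fun i => v i * w i).
  move=> [v' Tv vE] [w' Tw wE]; exists (fun i => v' i * w' i).
    exact: semisimple_coordsM.
  by move=> i; rewrite vE wE exprMn.
have [gs [gs_frob gs_van gs_gen]] := frobenius_generators T0 TD TM.
have [S AS] := zariski_closed_basis b_basis A_closed.
have AX c : A c -> A (c ^+ q).
  move=> Ac; have: (0 < q)%N := char_power_gt0 q_pow.
  case: (q) => // k _; elim: k => [|k IH]; first by rewrite expr1.
  by rewrite exprS; apply: AM.
move=> Aa; set s := part _; have As : A s.
  apply/AS => f Sf.
  have f_gs : in_generated_ideal gs f.
    apply: gs_gen => v [w [c Ac wE] vE].
    have <- : mpoly_fun b f (c ^+ q) = f.@[v].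
      apply: meval_eq => i; rewrite power_part coord_part vE wE.
      by case: ifP => //; rewrite expr0n gtn_eqF ?(char_power_gt0 q_pow).
    by have /AS := AX _ Ac; apply.
  apply: in_ideal_meval f_gs => g g_gs.
  apply: (char_power_inj q_pow); rewrite expr0n gtn_eqF ?(char_power_gt0 q_pow) //.
  rewrite -(frobenius_type_meval_expr _ q_pow (gs_frob _ g_gs)).
  apply: (gs_van _ g_gs); exists (fun i => coord b i s) => //.
  by exists a => // i; rewrite coord_part.
apply/eqP; rewrite -subr_eq0; apply/eqP; apply: semiprime_reduced.
  exact: AB.
exists q; rewrite power_part /part big1 // => i iI.
rewrite linearB /= coord_part iI subrr expr0n gtn_eqF ?scale0r //.
exact: char_power_gt0 q_pow.
Qed.

Lemma coords_semisimple v : coords b A v <-> semisimple_coords v.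
Proof.
have coordE a i : A a -> coord b i a = if i \in I then coord b i a else 0.
  by move=> Aa; rewrite {1}(A_semisimple Aa) coord_part.
by split=> -[a Aa vE]; exists a => // i; rewrite vE -?coordE // coordE.
Qed.

Lemma coordsM_char v w :
  coords b A v -> coords b A w -> coords b A (fun i => v i * w i).
Proof. by rewrite !coords_semisimple; apply: semisimple_coordsM. Qed.

End Characteristic.

Lemma coords_zero b : coords b A (fun=> 0).
Proof. by exists 0 => // i; rewrite linear0. Qed.

Lemma coords_add b v w :
  coords b A v -> coords b A w -> coords b A (fun i => v i + w i).
Proof.
move=> [a Aa vE] [c Ac wE]; exists (a + c); first exact: AD.
by move=> i; rewrite vE wE linearD.
Qed.

Lemma coordsM_basis_pchar p : p \in [pchar K] ->
  exists2 b : n.-tuple B, basis_of {:B} b &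
    forall v w, coords b A v -> coords b A w -> coords b A (fun i => v i * w i).
Proof.
move=> pK; have [b [I [b_bas b_idem b_orth b_nil]]] := idempotent_nilpotent_basis B_comm.
have [l lP] : exists l : 'I_n -> nat, forall i, i \notin I -> b`_i ^+ l i = 0.
  apply: (@fin_all_exists _ (fun=> nat) (fun i l => i \notin I -> b`_i ^+ l = 0)).
  move=> i; have [iI|/b_nil [l lE]] := boolP (i \in I); first by exists 0%N.
  by exists l.
pose q := (p ^ (\max_i l i))%N.
have q_pow : char_power K q by right; exists p, (\max_i l i).
exists b => // v w; apply: (coordsM_char b_bas q_pow b_idem b_orth) => i iI.
have le_q : (l i <= q)%N.
  apply: leq_trans (leq_bigmax i) _.
  by rewrite ltnW // ltn_expl // prime_gt1 // (pcharf_prime pK).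
by rewrite -(subnK le_q) exprD lP // mulr0.
Qed.

(** An equation of [A], restricted to the line [K x], is a polynomial in one
    variable that vanishes at all natural numbers. *)
Lemma subspace_pchar0 : [pchar K] =i pred0 -> forall c x, A x -> A (c *: x).
Proof.
move=> /pcharf0P K0 c x Ax; have [S AS] := A_closed; apply/AS => f Sf.
pose P : {poly K} := \sum_(m <- msupp f)
  (f@_m * \prod_i coord b0 i x ^+ m i) *: 'X^(mdeg m).
have PE t : P.[t] = mpoly_fun b0 f (t *: x).
  rewrite /P /mpoly_fun mevalE horner_sum; apply: eq_bigr => m _.
  rewrite hornerZ hornerXn -mulrA; congr (_ * _).
  rewrite mdegE -prodrXr -big_split; apply: eq_bigr => i _ /=.
  by rewrite linearZ /= exprMn mulrC.
suff P0 : P = 0 by rewrite -PE P0 horner0.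
apply: contraTeq isT => P_nz.
have := @max_poly_roots _ P [seq k%:R | k <- seq.iota 0 (size P)] P_nz.
rewrite size_map size_iota ltnn; apply.
  apply/allP => _ /mapP [k _ ->]; rewrite /root PE.
  by have /AS := AZ k%:R Ax; rewrite rmorph_nat => ->.
rewrite map_inj_uniq ?iota_uniq // => j k.
wlog le_jk : j k / (j <= k)%N.
  by move=> W jk; case: (leqP j k) => [/W|/ltnW /W H]; [apply|symmetry; apply: H].
move=> /esym/eqP; rewrite -subr_eq0 -natrB // K0 subn_eq0 => le_kj.
by apply/eqP; rewrite eqn_leq le_jk.
Qed.

Lemma coordsM_basis_pchar0 : [pchar K] =i pred0 ->
  exists2 b : n.-tuple B, basis_of {:B} b &
    forall v w, coords b A v -> coords b A w -> coords b A (fun i => v i * w i).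
Proof.
move=> K0; have [V VP] := vspace_of_pred A0 AD (subspace_pchar0 K0).
have dirV : directv (V + V^C) by apply/directv_addP; rewrite capv_compl.
have [b b_bas bP] := adapted_basis (addv_complf V) dirV (vbasisP V).
rewrite size_tuple in bP.
have coord0 a (i : 'I_n) : A a -> (\dim V <= i)%N -> coord b i a = 0.
  move/VP => aV le_i; rewrite (coord_vbasis aV) linear_sum big1 //= => j _.
  have lt_j : (j < n)%N by apply: leq_trans (ltn_ord j) (dimvS (subvf V)).
  have := bP (Ordinal lt_j); rewrite /= ltn_ord => <-.
  rewrite linearZ /= (coord_free (Ordinal lt_j)) ?(basis_free b_bas) //.
  rewrite -val_eqE /= ltn_eqF ?mulr0 //.
  exact: leq_trans (ltn_ord j) le_i.
exists b => // v w [a Aa vE] [c Ac wE].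
exists (\sum_(i < n) (v i * w i) *: b`_i); last first.
  by move=> i; rewrite coord_sum_free // (basis_free b_bas).
apply/VP; rewrite rpred_sum // => i _; have := bP i.
case: (ltnP i (\dim V)) => [lt_i ->|le_i _].
  by rewrite memvZ // (basis_mem (vbasisP V)) // mem_nth // size_tuple.
by rewrite vE coord0 // mul0r scale0r mem0v.
Qed.

End Subalgebra.

Theorem theorem4p15 (F : fieldType) (K : closedFieldType)
    (iota : {rmorphism F -> K}) (B : falgType K)
    (B_comm : commutative (@GRing.mul B))
    (b0 : (\dim {:B}).-tuple B) (b0_basis : basis_of {:B} b0)
    (A : B -> Prop)
    (A_subalg : is_subalg iota A)
    (A_comm : commutative_on A)
    (A_semiprime : semiprime iota A)
    (A_closed : zariski_closed b0 A) :
  exists b : (\dim {:B}).-tuple B,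
    basis_of {:B} b /\
    exists gs : seq {mpoly K[\dim {:B}]},
      (forall g, g \in gs -> frobenius_type F g) /\
      (forall f, pol b A f <-> in_generated_ideal gs f).
Proof.
have [b b_bas bM] : exists2 b : (\dim {:B}).-tuple B, basis_of {:B} b &
    forall v w, coords b A v -> coords b A w -> coords b A (fun i => v i * w i).
  have [[p pK]|no_p] := classic (exists p, p \in [pchar K]).
    exact: (coordsM_basis_pchar B_comm A_subalg A_semiprime A_closed pK).
  apply: (coordsM_basis_pchar0 A_subalg A_closed) => p.
  by rewrite [RHS]inE; apply/negP => pK; apply: no_p; exists p.
exists b; split=> //; apply: (pol_frobenius_generators iota) => //.
  exact: coords_zero A_subalg b.
exact: coords_add A_subalg b.
Qed.
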